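(* Let $G$ be a finite simple graph, let $H$ be an induced subgraph of $G$, and let $S=\mathbb{K}[x_i,y_i : i\in V(G)]$ for a field $\mathbb{K}$. Then, for all $i,j\geq 0$ and all $s\geq 1$, \[\beta_{i,j}(S/J_H^s)\leq \beta_{i,j}(S/J_G^s).\]
   Context: For a finite simple graph $G$ with vertex set a set of integers, the binomial edge ideal is $J_G=(x_iy_j-x_jy_i : i<j,\ \{i,j\}\in E(G))$ in $\mathbb{K}[x_i,y_i:i\in V(G)]$ (standard grading). For a subgraph $H$ of $G$, $J_H$ is regarded as an ideal of $S$ (extended from $\mathbb{K}[x_i,y_i:i\in V(H)]$; the graded Betti numbers are the same over either ring). $H$ is an induced subgraph of $G$ if $V(H)\subseteq V(G)$ and two vertices of $H$ are adjacent in $H$ exactly when they are adjacent in $G$. $\beta_{i,j}(M)=\dim_{\mathbb{K}}\operatorname{Tor}_i^S(M,\mathbb{K})_j$ are the graded Betti numbers. *)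

(* Defs.v *)
From HB Require Import structures.
From mathcomp Require Import all_boot all_order all_algebra.
From mathcomp Require Import finmap mpoly.

Set Implicit Arguments.
Unset Strict Implicit.
Unset Printing Implicit Defensive.

Import Order.TTheory GRing.Theory Num.Theory.
Local Open Scope ring_scope.
Local Open Scope fset_scope.

Record sgraph := SGraph {
  vertices : {fset int};
  adj : rel int;
  adj_sym : ssrbool.symmetric adj;
  adj_irr : irreflexive adj;
  adj_vertices : forall a b : int,
    adj a b -> (a \in vertices) && (b \in vertices)
}.

Definition induced_subgraph (H G : sgraph) : Prop :=
  vertices H `<=` vertices G /\
  (forall a b : int,
     a \in vertices H -> b \in vertices H -> adj H a b = adj G a b).

(* K[x_v, y_v : v in V]: the first #|V| variables are the x_v and the last
   #|V| variables are the y_v, where V is listed by [enum_rank]. *)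
Definition edge_ring (K : fieldType) (V : {fset int}) :=
  {mpoly K[#|{: V}| + #|{: V}|]}.

Definition xvar (K : fieldType) (V : {fset int}) (v : V) : edge_ring K V :=
  'X_(lshift #|{: V}| (enum_rank v)).

Definition yvar (K : fieldType) (V : {fset int}) (v : V) : edge_ring K V :=
  'X_(rshift #|{: V}| (enum_rank v)).

Section Ideals.
Variable R : comNzRingType.

Definition ideal_gen (A : R -> Prop) (p : R) : Prop :=
  exists (k : nat) (c a : 'I_k -> R),
    (forall l, A (a l)) /\ p = \sum_(l < k) c l * a l.

Definition ideal_pow (I : R -> Prop) (s : nat) : R -> Prop :=
  ideal_gen (fun p => exists f : 'I_s -> R,
    (forall l, I (f l)) /\ p = \prod_(l < s) f l).

End Ideals.

(* The ideal J_H extended to K[x_v, y_v : v in V], for V(H) contained in V. *)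
Definition binomial_edge_ideal (K : fieldType) (V : {fset int}) (H : sgraph) :
    edge_ring K V -> Prop :=
  ideal_gen (fun p => exists a b : V,
    [/\ val a < val b, adj H (val a) (val b) &
        p = xvar K a * yvar K b - xvar K b * yvar K a]).

Section GradedBetti.
Variables (K : fieldType) (n : nat).
Local Notation S := {mpoly K[n]}.

(* Right multiplication by A is a homogeneous map of degree 0 from
   \bigoplus_a S(- d1 a) to \bigoplus_b S(- d0 b), whose elements are row
   vectors: each entry A a b is zero or homogeneous of degree d1 a - d0 b. *)
Definition graded_mx (p q : nat) (d1 : 'I_p -> nat) (d0 : 'I_q -> nat)
    (A : 'M[S]_(p, q)) : Prop :=
  forall a b m, m \in msupp (A a b) -> d1 a = (d0 b + mdeg m)%N.

(* A graded free resolution of S/I by finitely generated free modules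
   F_i = \bigoplus_(a < rk i) S(- shift i a),
     ... -> F_2 -> F_1 -> F_0 -> S/I -> 0,
   where F_(i+1) -> F_i is right multiplication by dif i and the augmentation
   F_0 -> S/I sends the a-th basis vector to the class of aug a. *)
Record graded_free_resolution (I : S -> Prop) := GradedFreeResolution {
  rk : nat -> nat;
  shift : forall i, 'I_(rk i) -> nat;
  dif : forall i, 'M[S]_(rk i.+1, rk i);
  aug : 'cV[S]_(rk 0);
  dif_graded : forall i, graded_mx (@shift i.+1) (@shift i) (dif i);
  aug_graded : graded_mx (@shift 0) (fun _ : 'I_1 => 0%N) aug;
  aug_surj : forall f : S, exists u : 'rV[S]_(rk 0), I (f - (u *m aug) 0 0);
  exact_aug : forall u : 'rV[S]_(rk 0),
    I ((u *m aug) 0 0) <-> exists v : 'rV[S]_(rk 1), u = v *m dif 0;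
  exact_dif : forall i (u : 'rV[S]_(rk i.+1)),
    u *m dif i = 0 <-> exists v : 'rV[S]_(rk i.+2), u = v *m dif i.+1
}.

Arguments rk {I} _ _.
Arguments shift {I} _ [i] _.
Arguments dif {I} _ _.
Arguments aug {I} _.

Section Tor.
Variables (I : S -> Prop) (F : graded_free_resolution I).

(* The differential F_(i+1) (x) K -> F_i (x) K, with K = S/(variables): only
   the constant coefficients of dif i survive. *)
Definition dif_tensor (i : nat) : 'M[K]_(rk F i.+1, rk F i) :=
  map_mx (fun f : S => f@_0%MM) (dif F i).

(* The row space of this diagonal 0-1 matrix is (F_i (x) K)_j. *)
Definition degree_part (i j : nat) : 'M[K]_(rk F i) :=
  diag_mx (\row_a (shift F a == j)%:R).

Definition cycles (i j : nat) : 'M[K]_(rk F i) :=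
  match i return 'M[K]_(rk F i) with
  | 0%N => degree_part 0 j
  | i'.+1 => (degree_part i'.+1 j :&: kermx (dif_tensor i'))%MS
  end.

Definition boundaries (i j : nat) : 'M[K]_(rk F i.+1, rk F i) :=
  degree_part i.+1 j *m dif_tensor i.

(* dim_K H_i(F (x) K)_j; the boundaries are cycles, so that the truncated
   subtraction is the dimension of the quotient. *)
Definition tor_dim (i j : nat) : nat :=
  (\rank (cycles i j) - \rank (boundaries i j))%N.

End Tor.

(* b = beta_{i,j}(S/I) = dim_K Tor_i^S(S/I, K)_j, where Tor is computed from
   some graded free resolution of S/I. *)
Definition is_graded_betti (I : S -> Prop) (i j b : nat) : Prop :=
  exists F : graded_free_resolution I, b = tor_dim F i j.

End GradedBetti.

(* Main.v *)
From HB Require Import structures.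
Require Import Defs.
From mathcomp Require Import all_boot all_order all_algebra.
From mathcomp Require Import finmap mpoly.

(* Let F and F' be graded free resolutions of S/J_H^s and S/J_G^s, and let rho
   be the endomorphism of S that kills the variables outside V(H). As J_H is
   contained in J_G, the identity of S lifts to a graded chain map
   phi : F -> F'; as rho maps J_G^s into J_H^s, it lifts to a rho-semilinear
   chain map psi : F' -> F. So psi o phi lifts rho on S/J_H^s.
   Another lift of rho is the identity modulo the variables: for a single
   variable z, the divided difference f |-> (f - rho f) / z preserves J_H^s,
   lifts to a twisted derivation delta of F, and 1 - z delta lifts rho; for
   several variables, compose. Two lifts of rho are homotopic, so psi o phi
   induces the identity on Tor(S/J_H^s, K) and phi is injective on Tor.
   A rho-semilinear map of free modules is encoded by a matrix M, as
   u |-> rho(u) M on row vectors. *)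

Set Implicit Arguments.
Unset Strict Implicit.
Unset Printing Implicit Defensive.

Import GRing.Theory.
Local Open Scope ring_scope.

(** * Ideals, generators and powers of ideals *)

Record is_ideal (R : comNzRingType) (I : R -> Prop) : Prop := IsIdeal {
  ideal0 : I 0;
  idealD : forall f g, I f -> I g -> I (f + g);
  idealM : forall c f, I f -> I (c * f)
}.

Section IdealGen.
Variables (R : comNzRingType) (A : R -> Prop).

Lemma ideal_gen_is_ideal : is_ideal (ideal_gen A).
Proof.
split.
- by exists 0%N, (fun=> 0), (fun=> 0); split; [case | rewrite big_ord0].
- move=> f g [k [c [a [Aa ->]]]] [k' [c' [a' [Aa' ->]]]].
  exists (k + k')%N,
    (fun l => match split l with inl l => c l | inr l => c' l end),
    (fun l => match split l with inl l => a l | inr l => a' l end).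
  split=> [l|]; first by case: (split l).
  rewrite big_split_ord /=; congr (_ + _); apply: eq_bigr => l _.
    by rewrite (unsplitK (inl l)).
  by rewrite (unsplitK (inr l)).
- move=> d f [k [c [a [Aa ->]]]].
  exists k, (fun l => d * c l), a; split=> //.
  by rewrite big_distrr /=; apply: eq_bigr => l _; rewrite mulrA.
Qed.

Lemma ideal_gen_ind (P : R -> Prop) :
    P 0 -> (forall f g, P f -> P g -> P (f + g)) ->
    (forall c a, A a -> P (c * a)) ->
  forall f, ideal_gen A f -> P f.
Proof.
move=> P0 PD PM f [k [c [a [Aa ->]]]].
by elim/big_ind: _ => // l _; apply: PM.
Qed.

Lemma sub_ideal_gen (I : R -> Prop) : is_ideal I ->
  (forall a, A a -> I a) -> forall f, ideal_gen A f -> I f.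
Proof.
move=> idI AI; apply: ideal_gen_ind; [exact: ideal0 | exact: idealD |].
by move=> c a /AI; apply: idealM.
Qed.

Lemma mem_ideal_gen a : A a -> ideal_gen A a.
Proof.
move=> Aa; exists 1%N, (fun=> 1), (fun=> a).
by split=> //; rewrite big_ord1 mul1r.
Qed.

End IdealGen.

Section IdealPow.
Variable R : comNzRingType.
Implicit Types A I : R -> Prop.

(** Names the predicate inside [ideal_pow], so that [ideal_pow I s] is convertible to
    [ideal_gen (fprod_of I s)]. *)
Definition fprod_of A (s : nat) (p : R) : Prop :=
  exists f : 'I_s -> R, (forall l, A (f l)) /\ p = \prod_(l < s) f l.

Lemma ideal_pow_is_ideal I s : is_ideal (ideal_pow I s).
Proof. exact: ideal_gen_is_ideal. Qed.

Lemma ideal_pow_rmorph (rho : {rmorphism R -> R}) I I' s :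
    (forall f, I f -> I' (rho f)) ->
  forall f, ideal_pow I s f -> ideal_pow I' s (rho f).
Proof.
move=> rhoI; have idI' := ideal_pow_is_ideal I' s.
apply: ideal_gen_ind => [|f g If Ig|c _ [a [Ia ->]]].
- by rewrite rmorph0; apply: ideal0.
- by rewrite rmorphD; apply: idealD.
rewrite rmorphM rmorph_prod; apply: idealM => //; apply: mem_ideal_gen.
by exists (fun l => rho (a l)); split=> // l; apply: rhoI.
Qed.

Lemma ideal_pow_mono I I' s : (forall f, I f -> I' f) ->
  forall f, ideal_pow I s f -> ideal_pow I' s f.
Proof. exact: (ideal_pow_rmorph (rho := idfun)). Qed.

(** By induction on the number of factors: the product is additive in the first factor and in the
    product of the others, so both may be taken to be multiples of generators. *)
Lemma ideal_gen_prod A s (f : 'I_s -> R) : (forall l, ideal_gen A (f l)) ->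
  ideal_gen (fprod_of A s) (\prod_(l < s) f l).
Proof.
elim: s f => [|s IHs] f Af.
  by apply: mem_ideal_gen; exists f; split=> // -[].
rewrite big_ord_recl; move: (IHs _ (fun l => Af (lift ord0 l))).
have idP := ideal_gen_is_ideal (fprod_of A s.+1).
elim/ideal_gen_ind: _ / (Af ord0) => [|u v IHu IHv w|c a Aa].
- by rewrite mul0r => _; apply: ideal0.
- by rewrite mulrDl; apply: idealD => //; [apply: IHu | apply: IHv].
elim/ideal_gen_ind: _ / => [|u v IHu IHv|d _ [b [Ab ->]]].
- by rewrite mulr0; apply: ideal0.
- by rewrite mulrDr; apply: idealD.
rewrite mulrACA; apply: idealM => //; apply: mem_ideal_gen.
exists (fun l => oapp b a (unlift ord0 l)).
split=> [l|]; first by case: (unlift ord0 l).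
rewrite big_ord_recl unlift_none; congr (_ * _).
by apply: eq_bigr => l _; rewrite liftK.
Qed.

(** Together with the converse [ideal_gen_pow], this reduces statements about the power of an ideal
    to products of the original generators, which here are homogeneous and fixed by the
    variable-killing maps. *)
Lemma ideal_pow_gen A s f :
  ideal_pow (ideal_gen A) s f -> ideal_gen (fprod_of A s) f.
Proof.
apply: sub_ideal_gen; first exact: ideal_gen_is_ideal.
by move=> _ [a [Aa ->]]; apply: ideal_gen_prod.
Qed.

Lemma ideal_gen_pow A s f :
  ideal_gen (fprod_of A s) f -> ideal_pow (ideal_gen A) s f.
Proof.
apply: sub_ideal_gen; first exact: ideal_pow_is_ideal.
move=> _ [a [Aa ->]]; apply: mem_ideal_gen; exists a; split=> // l.
exact: mem_ideal_gen.
Qed.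

End IdealPow.

(** * Free resolutions without grading, and lifting along them *)

Section IdealColumn.
Variables (R : comNzRingType) (I : R -> Prop).
Hypothesis idI : is_ideal I.

Definition cV_in p (b : 'cV[R]_p) : Prop := forall a, I (b a 0).

Lemma cV_inD p (b c : 'cV_p) : cV_in b -> cV_in c -> cV_in (b + c).
Proof. by move=> Ib Ic a; rewrite mxE; apply: idealD. Qed.

Lemma cV_inM p q (M : 'M_(q, p)) (b : 'cV_p) : cV_in b -> cV_in (M *m b).
Proof.
move=> Ib a; rewrite mxE.
by elim/big_ind: _ => *; [apply: ideal0 | apply: idealD | apply: idealM].
Qed.

Lemma cV_inN p (b : 'cV_p) : cV_in b -> cV_in (- b).
Proof. by move=> Ib; rewrite -[- b]mul1mx mulmxN -mulNmx; apply: cV_inM. Qed.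

End IdealColumn.

(** The degrees are forgotten, so that lifts are constructed by exactness alone; where a graded lift
    is required, it is recovered by taking homogeneous parts. *)
Record free_resolution (R : comNzRingType) (I : R -> Prop) := FreeResolution {
  frk : nat -> nat;
  fdif : forall i, 'M[R]_(frk i.+1, frk i);
  faug : 'cV[R]_(frk 0);
  faug_surj : forall f, exists u : 'rV[R]_(frk 0), I (f - (u *m faug) 0 0);
  fexact_aug : forall u : 'rV[R]_(frk 0),
    I ((u *m faug) 0 0) <-> exists v : 'rV[R]_(frk 1), u = v *m fdif 0;
  fexact_dif : forall i (u : 'rV[R]_(frk i.+1)),
    u *m fdif i = 0 <-> exists v : 'rV[R]_(frk i.+2), u = v *m fdif i.+1
}.

Section Lifting.
Variables (R : comNzRingType) (I : R -> Prop) (F : free_resolution I).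

Local Notation rk := (frk F).
Local Notation dif := (fdif F).
Local Notation aug := (faug F).

Lemma aug_lift p (b : 'cV[R]_p) :
  exists Y : 'M[R]_(p, rk 0), cV_in I (b - Y *m aug).
Proof.
have [Y bY] := fin_all_exists (fun a => faug_surj F (b a 0)).
exists (\matrix_a Y a) => a; move: (bY a).
by rewrite -[Y a](rowK Y a) -row_mul !mxE.
Qed.

Lemma aug_dif : cV_in I (dif 0 *m aug).
Proof.
move=> a; suff: I ((row a (dif 0) *m aug) 0 0) by rewrite -row_mul mxE.
by apply/fexact_aug; exists (delta_mx 0 a); rewrite -rowE.
Qed.

Lemma dif_dif i : dif i.+1 *m dif i = 0.
Proof.
apply/row_matrixP => a; rewrite row_mul row0.
by apply/fexact_dif; exists (delta_mx 0 a); rewrite -rowE.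
Qed.

Lemma exact_aug_mx p (B : 'M[R]_(p, rk 0)) :
  cV_in I (B *m aug) -> exists V, B = V *m dif 0.
Proof.
move=> IB; have ex a : exists v, row a B = v *m dif 0.
  by apply/fexact_aug; rewrite -row_mul [row _ _ _ _]mxE; apply: IB.
have [V BV] := fin_all_exists ex; exists (\matrix_a V a).
by apply/row_matrixP => a; rewrite row_mul rowK.
Qed.

Lemma exact_dif_mx p i (B : 'M[R]_(p, rk i.+1)) :
  B *m dif i = 0 -> exists V, B = V *m dif i.+1.
Proof.
move=> B0; have ex a : exists v, row a B = v *m dif i.+1.
  by apply/fexact_dif; rewrite -row_mul B0 row0.
have [V BV] := fin_all_exists ex; exists (\matrix_a V a).
by apply/row_matrixP => a; rewrite row_mul rowK.
Qed.

(** The recursion common to chain maps, twisted derivations and homotopies. [B i Y] is the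
    prescribed value of [Y i.+1 *m dif i]; the hypotheses say that it is always a cycle, hence a
    boundary by exactness. *)
Lemma lift_complex (p : nat -> nat)
    (B : forall i, 'M[R]_(p i, rk i) -> 'M[R]_(p i.+1, rk i))
    (Y0 : 'M[R]_(p 0, rk 0)) :
    cV_in I (B 0%N Y0 *m aug) ->
    (forall i Y Y', Y' *m dif i = B i Y -> B i.+1 Y' *m dif i = 0) ->
  exists Y : forall i, 'M[R]_(p i, rk i),
    Y 0%N = Y0 /\ forall i, Y i.+1 *m dif i = B i (Y i).
Proof.
move=> B0 BS.
(* The invariant of the recursion: the next equation is solvable. Boolean equality makes the witness
   available to [xchoose]. *)
pose P i Y := exists V, B i Y == V *m dif i.
have P0 : P 0%N Y0 by have [V /eqP BV] := exact_aug_mx B0; exists V.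
have PS i Y (PY : P i Y) : P i.+1 (xchoose PY).
  have /eqP/esym/BS/exact_dif_mx[V /eqP BV] := xchooseP PY.
  by exists V.
pose Y := fix Y i : {Y | P i Y} := match i with
  | 0%N => exist _ Y0 P0
  | i'.+1 => exist _ _ (PS i' _ (svalP (Y i')))
  end.
exists (fun i => sval (Y i)); split=> // i /=.
exact/esym/eqP/(xchooseP (svalP (Y i))).
Qed.

End Lifting.

(** * Divided differences as twisted derivations *)

Section DividedDifference.
Variables (R : comNzRingType) (z : R) (rho : {rmorphism R -> R}).
Variable delta : R -> R.
Hypothesis z_reg : forall f g : R, z * f = z * g -> f = g.
Hypothesis deltaE : forall f : R, z * delta f = f - rho f.

Lemma divdiffD f g : delta (f + g) = delta f + delta g.
Proof. by apply: z_reg; rewrite mulrDr !deltaE rmorphD opprD addrACA. Qed.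

Lemma divdiffM f g : delta (f * g) = delta f * g + rho f * delta g.
Proof.
apply: z_reg; rewrite mulrDr mulrA mulrCA !deltaE rmorphM.
by rewrite mulrBl mulrBr addrA subrK.
Qed.

Lemma divdiff_fixed f : rho f = f -> delta f = 0.
Proof. by move=> kf; apply: z_reg; rewrite deltaE kf subrr mulr0. Qed.

Lemma divdiff_mxE p q (M : 'M_(p, q)) :
  z *: map_mx delta M = M - map_mx rho M.
Proof. by apply/matrixP => a b; rewrite !mxE deltaE. Qed.

Lemma divdiff_mxM p q r (M : 'M_(p, q)) (N : 'M_(q, r)) :
  map_mx delta (M *m N) = map_mx delta M *m N + map_mx rho M *m map_mx delta N.
Proof.
suff /matrixP E : z *: map_mx delta (M *m N)
    = z *: (map_mx delta M *m N + map_mx rho M *m map_mx delta N).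
  by apply/matrixP => a b; apply: z_reg; move: (E a b); rewrite mxE [RHS]mxE.
rewrite scalerDr scalemxAl scalemxAr !divdiff_mxE map_mxM.
by rewrite mulmxBl mulmxBr addrA subrK.
Qed.

End DividedDifference.

(** * Semilinear lifts that become the identity after tensoring *)

Section UnipotentLift.
Variables (R : comNzRingType) (I : R -> Prop) (F : free_resolution I).
Variables (k : comNzRingType) (eps : {rmorphism R -> k}).
Hypothesis idI : is_ideal I.

Local Notation rk := (frk F).
Local Notation dif := (fdif F).
Local Notation aug := (faug F).

(* A [rho]-semilinear chain map over [rho : R/I -> R/I], given on rows by
   [u |-> rho(u) T], that becomes the identity on [F (x) k]. *)
Definition has_unipotent_lift (rho : R -> R) : Prop :=
  exists T : forall i, 'M[R]_(rk i),
    [/\ cV_in I (T 0%N *m aug - map_mx rho aug),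
        forall i, T i.+1 *m dif i = map_mx rho (dif i) *m T i
      & forall i, map_mx eps (T i) = 1%:M].

Lemma unipotent_lift_id : has_unipotent_lift idfun.
Proof.
exists (fun i => 1%:M); split=> [|i|i]; last by rewrite map_mx1.
  by move=> a; rewrite mul1mx map_mx_id // subrr mxE; apply: ideal0.
by rewrite mul1mx mulmx1 map_mx_id.
Qed.

(** Composing the row maps gives [rho'(rho(u) T) T' = rho'(rho(u)) rho'(T) T'], and [eps] does not
    see [rho']. *)
Lemma unipotent_lift_comp (rho rho' : {rmorphism R -> R}) :
    (forall f, I f -> I (rho' f)) -> (forall f, eps (rho' f) = eps f) ->
    has_unipotent_lift rho -> has_unipotent_lift rho' ->
  has_unipotent_lift (rho' \o rho).
Proof.
move=> Irho' rho'0 [T [T0 TS T1]] [T' [T'0 T'S T'1]].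
exists (fun i => map_mx rho' (T i) *m T' i); split=> [|i|i].
- have Irho'T : cV_in I (map_mx rho' (T 0%N *m aug - map_mx rho aug)).
    by move=> a; rewrite mxE; apply: Irho'; apply: T0.
  have := cV_inD idI (cV_inM idI (map_mx rho' (T 0%N)) T'0) Irho'T.
  by rewrite map_mxB map_mxM mulmxBr addrA subrK mulmxA -map_mx_comp.
- by rewrite -mulmxA T'S mulmxA -map_mxM TS map_mxM -map_mx_comp mulmxA.
- rewrite map_mxM T'1 mulmx1 -(T1 i).
  by apply/matrixP => a b; rewrite !mxE rho'0.
Qed.

(* With [D] lifting the divided difference [delta f = (f - rho f) / z], the lift
   of [rho] is [1 - z D]. *)
Lemma unipotent_lift_divdiff (z : R) (rho : {rmorphism R -> R})
    (delta : R -> R) :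
    eps z = 0 -> (forall f g, z * f = z * g -> f = g) ->
    (forall f, z * delta f = f - rho f) ->
    (forall f, I f -> I (delta f)) ->
  has_unipotent_lift rho.
Proof.
move=> z0 z_reg deltaE Idelta.
have delta_mxM := divdiff_mxM z_reg deltaE.
have [D0 D0P] := aug_lift F (map_mx delta (aug)).
(* The derivation of [F] is [u |-> delta(u) + rho(u) D]. By the twisted Leibniz rule, it commutes
   with the differentials exactly when [D i.+1 *m dif i] has this value. *)
pose B i (Y : 'M[R]_(rk i)) :=
  map_mx delta (dif i) + map_mx rho (dif i) *m Y.
have [|i Y Y' EY|D [D00 DS]] := @lift_complex _ _ F rk B D0.
- have Idd : cV_in I (map_mx delta (dif 0 *m aug)).
    by move=> a; rewrite mxE; apply: Idelta; apply: aug_dif.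
  have := cV_inD idI Idd (cV_inN idI (cV_inM idI (map_mx rho (dif 0)) D0P)).
  by rewrite delta_mxM -mulmxN opprB mulmxBr addrA addrAC addrK mulmxA -mulmxDl.
- rewrite /B mulmxDl -mulmxA EY /B mulmxDr addrA -delta_mxM mulmxA -map_mxM.
  rewrite dif_dif map_mx0 mul0mx addr0.
  by apply/matrixP => a b; rewrite !mxE (divdiff_fixed z_reg deltaE) ?rmorph0.
(* Indeed [u - z (delta(u) + rho(u) D) = rho(u) (1 - z D)], which is [rho]-semilinear in [u]. *)
exists (fun i => 1%:M - z *: D i); split=> [|i|i].
- rewrite mulmxBl mul1mx addrAC -(divdiff_mxE deltaE) -scalemxAl -scalerBr D00.
  by move=> a; rewrite mxE; apply: idealM.
- rewrite mulmxBl mul1mx mulmxBr mulmx1 -scalemxAl DS /B -scalemxAr.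
  by rewrite scalerDr (divdiff_mxE deltaE) opprD addrA subKr.
- by rewrite map_mxB map_mx1 map_mxZ /= z0 scale0r subr0.
Qed.

End UnipotentLift.

(** * Chain maps between resolutions and homotopies *)

Section Comparison.
Variables (R : comNzRingType) (I I' : R -> Prop).
Variables (F : free_resolution I) (F' : free_resolution I').
Variables (k : comNzRingType) (eps : {rmorphism R -> k}).

Definition is_chain_map (phi : forall i, 'M[R]_(frk F i, frk F' i)) : Prop :=
  cV_in I' (faug F - phi 0%N *m faug F') /\
  forall i, phi i.+1 *m fdif F' i = fdif F i *m phi i.

Lemma chain_map_ex : is_ideal I' -> (forall f, I f -> I' f) ->
  exists phi, is_chain_map phi.
Proof.
move=> idI' II'; have [phi0 phi0P] := aug_lift F' (faug F).
pose B i (Y : 'M[R]_(frk F i, frk F' i)) := fdif F i *m Y.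
have [|i Y Y' EY|phi [phi00 phiS]] := @lift_complex _ _ F' (frk F) B phi0.
- have Idd : cV_in I' (fdif F 0 *m faug F).
    by move=> a; apply: II'; apply: aug_dif.
  have := cV_inD idI' Idd (cV_inN idI' (cV_inM idI' (fdif F 0) phi0P)).
  by rewrite -mulmxN opprB mulmxBr addrCA subrr addr0 /B -mulmxA.
- by rewrite /B -mulmxA EY /B mulmxA dif_dif mul0mx.
by exists phi; split=> //; rewrite phi00.
Qed.

(** The semilinear maps given by [psi] after [phi] and by [T] both lift [rho] on [R/I], so their
    difference lifts 0 and is null-homotopic. Applying [eps] removes [rho] and turns [T] into the
    identity. *)
Lemma retract_homotopy (rho : {rmorphism R -> R}) phi :
    is_ideal I -> (forall f, I' f -> I (rho f)) ->
    (forall f, eps (rho f) = eps f) ->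
    has_unipotent_lift F eps rho -> is_chain_map phi ->
  exists (psi : forall i, 'M[k]_(frk F' i, frk F i))
         (h : forall i, 'M[k]_(frk F i, frk F i.+1)),
    [/\ forall i, psi i.+1 *m map_mx eps (fdif F i)
                    = map_mx eps (fdif F' i) *m psi i,
        map_mx eps (phi 0%N) *m psi 0%N
          = 1%:M + h 0%N *m map_mx eps (fdif F 0)
      & forall i, map_mx eps (phi i.+1) *m psi i.+1
          = 1%:M + (h i.+1 *m map_mx eps (fdif F i.+1)
                    + map_mx eps (fdif F i) *m h i)].
Proof.
move=> idI rhoI rho0 [T [T0 TS T1]] [phi0 phiS].
have eps_rho p q (M : 'M_(p, q)) : map_mx eps (map_mx rho M) = map_mx eps M.
  by apply/matrixP => a b; rewrite !mxE rho0.
have [psi0 psi0P] := aug_lift F (map_mx rho (faug F')).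
pose B i (Y : 'M[R]_(frk F' i, frk F i)) := map_mx rho (fdif F' i) *m Y.
have [|i Y Y' EY|psi [psi00 psiS]] := @lift_complex _ _ F (frk F') B psi0.
- have Idd : cV_in I (map_mx rho (fdif F' 0 *m faug F')).
    by move=> a; rewrite mxE; apply: rhoI; apply: aug_dif.
  have := cV_inM idI (map_mx rho (fdif F' 0)) psi0P.
  move=> /(cV_inN idI) /(cV_inD idI Idd).
  by rewrite -mulmxN opprB mulmxBr map_mxM addrCA subrr addr0 /B -mulmxA.
- by rewrite /B -mulmxA EY /B mulmxA -map_mxM dif_dif map_mx0 mul0mx.
(* Since [rho(u phi) psi = rho(u) rho(phi) psi], the matrix of the composite is [rho(phi) psi]. *)
pose E i := map_mx rho (phi i) *m psi i - T i.
have E0 : cV_in I (E 0%N *m faug F).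
  have Iphi : cV_in I (map_mx rho (faug F - phi 0%N *m faug F')).
    by move=> a; rewrite mxE; apply: rhoI; apply: phi0.
  have := cV_inM idI (map_mx rho (phi 0%N)) psi0P.
  move=> /(cV_inD idI Iphi) /(cV_inD idI T0) /(cV_inN idI).
  rewrite map_mxB map_mxM mulmxBr /E mulmxBl psi00 mulmxA.
  by rewrite [X in _ + X]addrA subrK addrA subrK opprB.
have ES i : E i.+1 *m fdif F i = map_mx rho (fdif F i) *m E i.
  rewrite mulmxBl TS mulmxBr -mulmxA psiS /B !mulmxA -!map_mxM phiS.
  by rewrite map_mxM.
have epsE i :
    map_mx eps (phi i) *m map_mx eps (psi i) = 1%:M + map_mx eps (E i).
  by rewrite map_mxB T1 map_mxM eps_rho addrC subrK.
(* The homotopy is a lift out of the complex F shifted by one, with the zero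
   module in degree 0. *)
clearbody E; pose p i := if i is i'.+1 then frk F i' else 0%N.
pose C i : 'M[R]_(p i, frk F i) -> 'M[R]_(p i.+1, frk F i) :=
  match i with
  | 0%N => fun=> E 0%N
  | i'.+1 => fun Y => E i'.+1 - map_mx rho (fdif F i') *m Y
  end.
have [//|[|i] Y Y' /= EY|h [_ hS]] := @lift_complex _ _ F p C 0.
- by rewrite mulmxBl -mulmxA EY ES subrr.
- rewrite mulmxBl -mulmxA EY ES mulmxBr opprB addrCA subrr addr0.
  by rewrite mulmxA -map_mxM dif_dif map_mx0 mul0mx.
(* Because of the shift in [p], the homotopy out of [F_i] is [h i.+1]. *)
exists (fun i => map_mx eps (psi i)), (fun i => map_mx eps (h i.+1)).
split=> [i||i].
- by rewrite -map_mxM psiS map_mxM eps_rho.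
- by rewrite epsE -map_mxM hS.
- by rewrite epsE -map_mxM hS /= map_mxB map_mxM eps_rho subrK.
Qed.

End Comparison.

Arguments is_chain_map {R I I'} F F' phi.

(** * Setting variables of a polynomial ring to zero *)

Section KillVar.
Variables (K : fieldType) (n : nat) (z : 'I_n).
Local Notation S := {mpoly K[n]}.

Definition killvar (f : S) : S :=
  f \mPo [tuple (if i == z then 0 else 'X_i) | i < n].

HB.instance Definition _ := GRing.RMorphism.copy killvar
  (comp_mpoly [tuple (if i == z then 0 else 'X_i) | i < n]).

Lemma killvarX i : killvar 'X_i = if i == z then 0 else 'X_i.
Proof. by rewrite /killvar comp_mpolyXU -tnth_nth tnth_mktuple. Qed.

Lemma killvarC c : killvar c%:MP = c%:MP.
Proof. exact: comp_mpolyC. Qed.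

(** Divisibility of [f - killvar f] by ['X_z] is clear for variables, and passes to products by the
    twisted Leibniz formula and to linear combinations. *)
Lemma divdiff_ex (f : S) : exists g, f - killvar f == 'X_z * g.
Proof.
elim/mpolyind: f => [|c m f _ _ [g /eqP fg]].
  by exists 0; rewrite rmorph0 subrr mulr0.
have [h mh] : exists h, 'X_[m] - killvar 'X_[m] = 'X_z * h.
  rewrite mpolyXE_id; elim/big_ind: _ => [|u v [gu Eu] [gv Ev]|i _].
  - by exists 0; rewrite rmorph1 subrr mulr0.
  - exists (gu * v + killvar u * gv).
    rewrite mulrDr mulrA -Eu mulrCA -Ev rmorphM.
    by rewrite mulrBl mulrBr addrA subrK.
  elim: (m i) => [|k [g' Eg']].
    by exists 0; rewrite expr0 rmorph1 subrr mulr0.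
  have [g1 Eg1]: exists g1, 'X_i - killvar 'X_i = 'X_z * g1.
    rewrite killvarX; have [->|_] := eqVneq.
      by exists 1; rewrite subr0 mulr1.
    by exists 0; rewrite subrr mulr0.
  exists (g1 * 'X_i ^+ k + killvar 'X_i * g').
  rewrite mulrDr mulrA -Eg1 mulrCA -Eg' exprS rmorphM.
  by rewrite mulrBl mulrBr addrA subrK.
exists (c%:MP * h + g); apply/eqP.
rewrite rmorphD -mul_mpolyC rmorphM /= killvarC opprD addrACA -mulrBr.
by rewrite fg mh mulrDr mulrCA.
Qed.

Definition divdiff (f : S) : S := xchoose (divdiff_ex f).

Lemma divdiffE (f : S) : 'X_z * divdiff f = f - killvar f.
Proof. exact/esym/eqP/(xchooseP (divdiff_ex f)). Qed.

Lemma mulXI (f g : S) : 'X_z * f = 'X_z * g -> f = g.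
Proof. by apply: mulfI; rewrite -msupp_eq0 msuppX. Qed.

Lemma mcoeff0_killvar (f : S) : (killvar f)@_0%MM = f@_0%MM.
Proof.
have /(congr1 (mcoeff 0%MM)) := divdiffE f.
rewrite rmorphM rmorphB /= mcoeffX -mdeg_eq0 mdeg1 mul0r => /esym/eqP.
by rewrite subr_eq0 => /eqP.
Qed.

End KillVar.


Lemma unipotent_lift_killvars (K : fieldType) (n : nat)
    (I : {mpoly K[n]} -> Prop) (F : free_resolution I) (zs : seq 'I_n) :
    is_ideal I ->
    (forall z, z \in zs -> forall f, I f -> I (divdiff z f)) ->
  exists rho : {rmorphism {mpoly K[n]} -> {mpoly K[n]}},
    [/\ forall i, rho 'X_i = if i \in zs then 0 else 'X_i,
        forall f : {mpoly K[n]}, (rho f)@_0%MM = f@_0%MM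
      & has_unipotent_lift F (mcoeff 0%MM) rho].
Proof.
move=> idI; elim: zs => [_|z zs IHzs Idiv].
  by exists idfun; split=> //; apply: unipotent_lift_id.
have [y y_zs|rho [rhoX rho0 lift_rho]] := IHzs.
  by apply: Idiv; rewrite inE y_zs orbT.
have {}Idiv := Idiv z (mem_head z zs).
exists (killvar z \o rho); split=> [i|f|].
- rewrite /= rhoX inE; case: (i \in zs); first by rewrite rmorph0 orbT.
  by rewrite killvarX orbF.
- by rewrite /= mcoeff0_killvar rho0.
apply: unipotent_lift_comp lift_rho _ => //.
(* [killvar z] preserves [I] because [killvar z f = f - 'X_z * divdiff z f]. *)
- move=> f If; rewrite /= -[killvar z f](subKr f) -divdiffE -mulNr.
  by apply: (idealD idI) => //; apply: (idealM idI); apply: Idiv.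
- exact: mcoeff0_killvar.
apply: (unipotent_lift_divdiff _ idI _ (@mulXI _ _ z) (divdiffE z)) => //.
by rewrite /= mcoeffX -mdeg_eq0 mdeg1.
Qed.

(** * Homogeneous components of polynomials and matrices *)

Section HomogeneousPart.
Variables (K : fieldType) (n : nat).
Local Notation S := {mpoly K[n]}.

(* The component of degree [d1 - d0] of [f], which is 0 when [d1 < d0]. *)
Definition hpart (d1 d0 : nat) (f : S) : S :=
  \sum_(m <- msupp f | d1 == (d0 + mdeg m)%N) f@_m *: 'X_[m].

Lemma mcoeff_hpart d1 d0 f m :
  (hpart d1 d0 f)@_m = if d1 == (d0 + mdeg m)%N then f@_m else 0.
Proof.
rewrite /hpart raddf_sum /= big_mkcond /=.
have [m_f|/[dup] m_f /memN_msupp_eq0 ->] := boolP (m \in msupp f).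
  rewrite (bigD1_seq m) //= big1 ?addr0 => [|m' /negPf m'm].
    by case: ifP => // _; rewrite mcoeffZ mcoeffX eqxx mulr1.
  by case: ifP => // _; rewrite mcoeffZ mcoeffX m'm mulr0.
rewrite if_same big_seq big1 // => m' m'_f; case: ifP => // _.
rewrite mcoeffZ mcoeffX; have [m'm|_] := eqVneq m' m; last by rewrite mulr0.
by rewrite m'm (negPf m_f) in m'_f.
Qed.

Lemma hpart_is_additive d1 d0 : additive (hpart d1 d0).
Proof.
move=> f g; apply/mpolyP => m; rewrite mcoeffB !mcoeff_hpart.
by case: ifP => _; rewrite ?subr0 // mcoeffB.
Qed.

HB.instance Definition _ d1 d0 :=
  GRing.isAdditive.Build S S (hpart d1 d0) (hpart_is_additive d1 d0).

(** The hypothesis says that multiplying by a term of [g] shifts degrees from [e1 - e0] to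
    [d1 - d0]. Stated as an equivalence of equations, it avoids truncated subtraction and covers a
    change of either the source or the target degree. *)
Lemma hpartM (d1 d0 e1 e0 : nat) (f g : S) :
    (forall m m' : 'X_{1..n}, m' \in msupp g ->
      (d1 == d0 + (mdeg m + mdeg m'))%N = (e1 == e0 + mdeg m)%N) ->
  hpart d1 d0 (f * g) = hpart e1 e0 f * g.
Proof.
move=> hom_g; apply/mpolyP => m; rewrite mcoeff_hpart !mcoeffM.
rewrite [RHS](eq_bigr (fun k : 'X_{1..n < (mdeg m).+1, (mdeg m).+1} =>
  if d1 == (d0 + mdeg m)%N then f@_k.1 * g@_k.2 else 0)) => [|k /eqP km].
  by case: ifP => // _; rewrite big1.
rewrite mcoeff_hpart.
have [k2|/memN_msupp_eq0 ->] := boolP ((k.2 : 'X_{1..n}) \in msupp g).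
  by rewrite -(hom_g _ _ k2) -mdegD -km; case: ifP => // _; rewrite mul0r.
by rewrite !mulr0 if_same.
Qed.

Lemma hpartMr d2 d1 d0 (f g : S) :
    (forall m : 'X_{1..n}, m \in msupp g -> d1 = (d0 + mdeg m)%N) ->
  hpart d2 d0 (f * g) = hpart d2 d1 f * g.
Proof.
move=> hom_g; apply: hpartM => m m' /hom_g ->.
by rewrite -addnA [(mdeg m' + _)%N]addnC.
Qed.

Lemma hpartMl d2 d1 d0 (f g : S) :
    (forall m : 'X_{1..n}, m \in msupp f -> d2 = (d1 + mdeg m)%N) ->
  hpart d2 d0 (f * g) = f * hpart d1 d0 g.
Proof.
move=> hom_f; rewrite mulrC [RHS]mulrC; apply: hpartM => m m' /hom_f ->.
by rewrite addnA eqn_add2r.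
Qed.

Definition hpart_mx p q (d1 : 'I_p -> nat) (d0 : 'I_q -> nat)
    (A : 'M[S]_(p, q)) :=
  \matrix_(a, b) hpart (d1 a) (d0 b) (A a b).

Lemma hpart_mxB p q (d1 : 'I_p -> nat) (d0 : 'I_q -> nat) (A B : 'M[S]_(p, q)) :
  hpart_mx d1 d0 (A - B) = hpart_mx d1 d0 A - hpart_mx d1 d0 B.
Proof. by apply/matrixP => a b; rewrite !mxE raddfB. Qed.

Lemma hpart_mxMr p q r (d2 : 'I_p -> nat) (d1 : 'I_q -> nat) (d0 : 'I_r -> nat)
    (A : 'M_(p, q)) (B : 'M_(q, r)) : graded_mx d1 d0 B ->
  hpart_mx d2 d0 (A *m B) = hpart_mx d2 d1 A *m B.
Proof.
move=> hom_B; apply/matrixP => a b; rewrite !mxE raddf_sum.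
by apply: eq_bigr => c _; rewrite !mxE; apply: hpartMr; apply: hom_B.
Qed.

Lemma hpart_mxMl p q r (d2 : 'I_p -> nat) (d1 : 'I_q -> nat) (d0 : 'I_r -> nat)
    (A : 'M_(p, q)) (B : 'M_(q, r)) : graded_mx d2 d1 A ->
  hpart_mx d2 d0 (A *m B) = A *m hpart_mx d1 d0 B.
Proof.
move=> hom_A; apply/matrixP => a b; rewrite !mxE raddf_sum.
by apply: eq_bigr => c _; rewrite !mxE; apply: hpartMl; apply: hom_A.
Qed.

Lemma graded_hpart_mx p q (d1 : 'I_p -> nat) (d0 : 'I_q -> nat)
    (A : 'M_(p, q)) : graded_mx d1 d0 (hpart_mx d1 d0 A).
Proof.
move=> a b m; rewrite mcoeff_msupp mxE mcoeff_hpart.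
by case: ifP => [/eqP|]; rewrite ?eqxx.
Qed.

Lemma hpart_mx_id p q (d1 : 'I_p -> nat) (d0 : 'I_q -> nat)
    (A : 'M_(p, q)) : graded_mx d1 d0 A -> hpart_mx d1 d0 A = A.
Proof.
move=> hom_A; apply/matrixP => a b; apply/mpolyP => m.
rewrite mxE mcoeff_hpart; case: ifP => // /negP d1m.
by rewrite memN_msupp_eq0 //; apply/negP => /hom_A/eqP.
Qed.

End HomogeneousPart.

Definition ungraded (K : fieldType) (n : nat) (I : {mpoly K[n]} -> Prop)
    (F : graded_free_resolution I) : free_resolution I :=
  FreeResolution (aug_surj F) (@exact_aug _ _ _ F) (@exact_dif _ _ _ F).

(** * Linear algebra: comparing dimensions of homology *)

Section RankHomology.
Variable k : fieldType.

Lemma rank_homology_le (m n p p' q r : nat)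
    (Z : 'M[k]_(m, n)) (B : 'M[k]_(p, n))
    (Z' : 'M[k]_(q, r)) (B' : 'M[k]_(p', r)) (phi : 'M[k]_(n, r)) :
    (Z *m phi <= Z')%MS -> (B' <= Z')%MS ->
    (forall u : 'rV_n, (u <= Z)%MS -> (u *m phi <= B')%MS -> (u <= B)%MS) ->
  (\rank Z - \rank B <= \rank Z' - \rank B')%N.
Proof.
move=> Zphi B'Z' injB; pose C := (Z :\: B)%MS.
have injC (u : 'rV_n) : (u <= C)%MS -> (u *m phi <= B')%MS -> u = 0.
  move=> uC uB'; apply/eqP; rewrite -submx0 -(capmx_diff Z B) sub_capmx uC.
  by apply: injB uB'; apply: submx_trans uC (diffmxSl _ _).
have rkCphi : \rank (C *m phi) = \rank C.
  apply/mxrank_injP; rewrite -submx0; apply/rV_subP => u.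
  rewrite sub_capmx submx0 => /andP[uC /sub_kermxP u0].
  by apply/eqP/injC => //; rewrite u0 sub0mx.
have CB' : (C *m phi :&: B')%MS = 0.
  apply/eqP; rewrite -submx0; apply/rV_subP => u; rewrite sub_capmx.
  move=> /andP[/submxP[v ->]]; rewrite mulmxA => vB'.
  by rewrite (injC (v *m C)) ?submxMl // mul0mx sub0mx.
have CphiZ' : (C *m phi + B' <= Z')%MS.
  rewrite addsmx_sub B'Z' andbT (submx_trans _ Zphi) // submxMr //.
  exact: diffmxSl.
have := mxrankS CphiZ'; rewrite mxrank_disjoint_sum // rkCphi => leC.
apply: (@leq_trans (\rank C)); last by rewrite leq_subRL -1?addnC // mxrankS.
rewrite leq_subLR -(mxrank_cap_compl Z B) leq_add2r mxrankS //.
exact: capmxSr.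
Qed.

End RankHomology.

(** * Graded chain maps and the comparison of Tor *)

Section GradedComparison.
Variables (K : fieldType) (n : nat) (I I' : {mpoly K[n]} -> Prop).
Variables (F : graded_free_resolution I) (F' : graded_free_resolution I').
Local Notation S := {mpoly K[n]}.

(** Differentials and augmentations are homogeneous, so the degree 0 part of a lift satisfies the
    same equations; stability of [I'] under [hpart] takes care of the augmentation. *)
Lemma hpart_chain_map phi :
    (forall d f, I' f -> I' (hpart d 0 f)) ->
    is_chain_map (ungraded F) (ungraded F') phi ->
  is_chain_map (ungraded F) (ungraded F')
    (fun i => hpart_mx (@shift _ _ _ F i) (@shift _ _ _ F' i) (phi i)).
Proof.
move=> I'hpart [phi0 phiS]; split=> [|i].
  have := @hpart_mxB _ _ _ _ (@shift _ _ _ F 0) (fun _ => 0%N)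
    (aug F) (phi 0%N *m aug F').
  rewrite (hpart_mx_id (@aug_graded _ _ _ F)).
  rewrite (hpart_mxMr _ _ (@aug_graded _ _ _ F')) => <- a.
  by rewrite mxE; apply: I'hpart; apply: phi0.
have dF := @dif_graded _ _ _ F i; have dF' := @dif_graded _ _ _ F' i.
rewrite -(hpart_mxMr _ _ dF') -(hpart_mxMl _ _ dF).
by congr hpart_mx; apply: phiS.
Qed.

End GradedComparison.

Section DegreePart.
Variables (K : fieldType) (n : nat).
Local Notation S := {mpoly K[n]}.

(** Convertible to [degree_part] when [d] is the shift of a resolution. *)
Definition deg_mx p (d : 'I_p -> nat) (j : nat) : 'M[K]_p :=
  diag_mx (\row_a (d a == j)%:R).

Lemma deg_mx_idem p (d : 'I_p -> nat) j : deg_mx d j *m deg_mx d j = deg_mx d j.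
Proof.
apply/matrixP => a b; rewrite mul_diag_mx !mxE.
by case: (d a == j); rewrite ?mul1r // mul0r mul0rn.
Qed.

(** An entry with nonzero constant coefficient joins two basis vectors of equal degree. *)
Lemma deg_mx_comm p q (d1 : 'I_p -> nat) (d0 : 'I_q -> nat)
    (A : 'M[S]_(p, q)) j :
  graded_mx d1 d0 A ->
  deg_mx d1 j *m map_mx (mcoeff 0%MM) A = map_mx (mcoeff 0%MM) A *m deg_mx d0 j.
Proof.
move=> hom_A; apply/matrixP => a b; rewrite mul_diag_mx mul_mx_diag !mxE.
have [/hom_A ->|/memN_msupp_eq0 ->] := boolP (0%MM \in msupp (A a b)).
  by rewrite mdeg0 addn0 mulrC.
by rewrite mulr0 mul0r.
Qed.

Lemma deg_mxP p m (d : 'I_p -> nat) j (u : 'M_(m, p)) :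
  (u <= deg_mx d j)%MS -> u = u *m deg_mx d j.
Proof. by case/submxP => v ->; rewrite -mulmxA deg_mx_idem. Qed.

End DegreePart.

Section TorRetract.
Variables (K : fieldType) (n : nat) (I I' : {mpoly K[n]} -> Prop).
Variables (F : graded_free_resolution I) (F' : graded_free_resolution I').
Local Notation S := {mpoly K[n]}.
Local Notation eps := (mcoeff 0%MM : S -> K).
Hypotheses (idI : is_ideal I) (idI' : is_ideal I').

Lemma tor_dim_retract (rho : {rmorphism S -> S}) i j :
    (forall f, I f -> I' f) -> (forall f, I' f -> I (rho f)) ->
    (forall d f, I' f -> I' (hpart d 0 f)) ->
    (forall f : S, (rho f)@_0%MM = f@_0%MM) ->
    has_unipotent_lift (ungraded F) (mcoeff 0%MM) rho ->
  (tor_dim F i j <= tor_dim F' i j)%N.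
Proof.
move=> II' rhoI I'hpart rho0 rhoT.
have [phi0 /(hpart_chain_map I'hpart)] :=
  chain_map_ex (ungraded F) (ungraded F') idI' II'.
set phi := fun i => _; move=> phiP.
have [psi [h [psiS hom0 homS]]] := retract_homotopy idI rhoI rho0 rhoT phiP.
case: phiP => _ phiS.
pose P i := deg_mx K (@shift _ _ _ F i) j.
pose P' i := deg_mx K (@shift _ _ _ F' i) j.
pose d i := map_mx eps (dif F i); pose d' i := map_mx eps (dif F' i).
pose f i := map_mx eps (phi i).
have Pf l : P l *m f l = f l *m P' l.
  by apply: deg_mx_comm; apply: graded_hpart_mx.
have Pd l : P l.+1 *m d l = d l *m P l.
  by apply: deg_mx_comm; apply: dif_graded.
have Pd' l : P' l.+1 *m d' l = d' l *m P' l.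
  by apply: deg_mx_comm; apply: dif_graded.
have df l : d l *m f l = f l.+1 *m d' l.
  by rewrite -!map_mxM; congr map_mx; rewrite -phiS.
have dd' l : d' l.+1 *m d' l = 0.
  by rewrite -map_mxM (dif_dif (ungraded F')) map_mx0.
apply: (@rank_homology_le _ _ _ _ _ _ _ _ _ _ _ (f i)).
- case: i => [|i] /=; first by rewrite Pf submxMl.
  rewrite sub_capmx; apply/andP; split.
    by rewrite (submx_trans (submxMr _ (capmxSl _ _))) // Pf submxMl.
  apply/sub_kermxP; rewrite -mulmxA -df mulmxA.
  by rewrite (sub_kermxP (capmxSr _ _)) mul0mx.
- rewrite /boundaries -/(d' i) -/(P' i.+1) Pd'.
  case: i => [|i] /=; first by rewrite submxMl.
  rewrite sub_capmx submxMl /= -Pd'; apply/sub_kermxP.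
  by rewrite -mulmxA dd' mulmx0.
move=> u uZ /submxP[w Ew].
(* As [u *m f i] is a boundary, so is its image under [psi], and the homotopy makes this image
   differ from the cycle [u] by a boundary. *)
have [v Ev] : exists v, u = v *m d i.
  have EwS : u *m f i *m psi i = w *m P' i.+1 *m psi i.+1 *m d i.
    by rewrite Ew -!mulmxA psiS.
  case: i u w uZ Ew EwS => [|i] u w uZ Ew EwS.
    exists (w *m P' 1%N *m psi 1%N - u *m h 0%N).
    by rewrite mulmxBl -EwS -mulmxA hom0 mulmxDr mulmx1 mulmxA addrK.
  exists (w *m P' i.+2 *m psi i.+2 - u *m h i.+1).
  rewrite mulmxBl -EwS -mulmxA homS !mulmxDr mulmx1 !mulmxA.
  have /sub_kermxP -> : (u <= kermx (d i))%MS.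
    by apply: submx_trans uZ (capmxSr _ _).
  by rewrite mul0mx addr0 addrK.
(* [psi] and [h] are not known to be graded, so [v] may have components outside degree [j];
   projecting to degree [j], which commutes with [d], discards them. *)
have -> : u = u *m P i.
  apply: deg_mxP; case: i u uZ {w Ew v Ev} => [|i] u //.
  by rewrite sub_capmx => /andP[].
by rewrite Ev -mulmxA -Pd submxMl.
Qed.

End TorRetract.

(** * Powers of ideals with generators of one degree *)

Section HomogeneousIdeals.
Variables (K : fieldType) (n : nat).
Local Notation S := {mpoly K[n]}.
Implicit Type A : S -> Prop.

Lemma ideal_gen_hpart A e : (forall a, A a -> a \is e.-homog) ->
  forall d f, ideal_gen A f -> ideal_gen A (hpart d 0 f).
Proof.
move=> homA d f; have idA := ideal_gen_is_ideal A.
elim/ideal_gen_ind: _ / => [|u v|c a Aa].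
- by rewrite raddf0; apply: ideal0.
- by rewrite raddfD; apply: idealD.
rewrite (hpartMr _ (d1 := e)) => [|m /(dhomog_mf (homA _ Aa)) -> //].
by apply: (idealM idA); apply: mem_ideal_gen.
Qed.

Lemma fprod_of_homog A e s : (forall a, A a -> a \is e.-homog) ->
  forall p, fprod_of A s p -> p \is (s * e).-homog.
Proof.
move=> homA _ [f [Af ->]]; elim: s f Af => [|s IHs] f Af.
  by rewrite big_ord0 dhomog1.
by rewrite big_ord_recl mulSn dhomogM ?homA // IHs.
Qed.

Lemma ideal_pow_hpart A e s : (forall a, A a -> a \is e.-homog) ->
  forall d f, ideal_pow (ideal_gen A) s f ->
    ideal_pow (ideal_gen A) s (hpart d 0 f).
Proof.
move=> homA d f /ideal_pow_gen /(ideal_gen_hpart (fprod_of_homog homA) d).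
exact: ideal_gen_pow.
Qed.

End HomogeneousIdeals.

(** * Binomial edge ideals and induced subgraphs *)

Section BinomialEdgeIdeal.
Variables (K : fieldType) (V : {fset int}).
Local Notation S := (edge_ring K V).

Definition edge_binomial (H : sgraph) (p : S) : Prop :=
  exists a b : V, [/\ (val a < val b)%R, adj H (val a) (val b) &
    p = xvar K a * yvar K b - xvar K b * yvar K a].

Lemma edge_binomial_homog H p : edge_binomial H p -> p \is 2.-homog.
Proof.
case=> a [b [_ _ ->]]; have hX l : ('X_l : S) \is 1.-homog.
  by rewrite dhomogX /= mdeg1.
by apply: rpredB; apply: (dhomogM (d := 1) (e := 1)); apply: hX.
Qed.

Definition var_vertex (l : 'I_(#|{: V}| + #|{: V}|)) : V :=
  enum_val (match split l with inl a => a | inr a => a end).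

Lemma var_vertex_l (v : V) : var_vertex (lshift _ (enum_rank v)) = v.
Proof. by rewrite /var_vertex (unsplitK (inl _)) enum_rankK. Qed.

Lemma var_vertex_r (v : V) : var_vertex (rshift _ (enum_rank v)) = v.
Proof. by rewrite /var_vertex (unsplitK (inr _)) enum_rankK. Qed.

Definition outer_vars (H : sgraph) : seq 'I_(#|{: V}| + #|{: V}|) :=
  [seq l <- enum 'I__ | val (var_vertex l) \notin vertices H].

Lemma mem_outer_vars H l :
  (l \in outer_vars H) = (val (var_vertex l) \notin vertices H).
Proof. by rewrite mem_filter mem_enum andbT. Qed.

Lemma killvar_edge_binomial H z p :
  z \in outer_vars H -> edge_binomial H p -> killvar z p = p.
Proof.
move=> z_out [a [b [_ ab ->]]]; have /andP[aH bH] := adj_vertices ab.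
have kX l : val (var_vertex l) \in vertices H -> killvar z ('X_l : S) = 'X_l.
  move=> lH; rewrite killvarX; case: eqP => // lz.
  by rewrite -lz mem_outer_vars lH in z_out.
rewrite rmorphB !rmorphM /= /xvar /yvar.
by rewrite !kX ?var_vertex_l ?var_vertex_r.
Qed.

(** A product [a] of binomials of [H] is free of the variable [z], so its divided difference
    vanishes and [divdiff z (c * a) = divdiff z c * a]. *)
Lemma divdiff_ideal_pow H s z f : z \in outer_vars H ->
  ideal_pow (@binomial_edge_ideal K V H) s f ->
  ideal_pow (@binomial_edge_ideal K V H) s (divdiff z f).
Proof.
move=> z_out /ideal_pow_gen; set J := ideal_pow _ _ => Jf; apply: ideal_gen_pow.
have idJ := ideal_gen_is_ideal (fprod_of (edge_binomial H) s).
have D := divdiffD (@mulXI _ _ z) (divdiffE z).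
have M := divdiffM (@mulXI _ _ z) (divdiffE z).
have fixed := divdiff_fixed (@mulXI _ _ z) (divdiffE z).
elim/ideal_gen_ind: _ / Jf => [|u v Ju Jv|c _ [a [Aa ->]]].
- by rewrite fixed ?rmorph0 //; apply: ideal0.
- by rewrite D; apply: idealD.
rewrite M [X in _ + _ * X]fixed ?mulr0 ?addr0; last first.
  rewrite rmorph_prod; apply: eq_bigr => l _.
  by apply: (killvar_edge_binomial z_out).
by apply: (idealM idJ); apply: mem_ideal_gen; exists a.
Qed.

(** Both monomials of an edge binomial contain a variable of each endpoint, so [rho] kills the
    binomial if an endpoint lies outside [H]. Otherwise [rho] fixes it, and the edge belongs to [H]
    because [H] is induced. *)
Lemma retract_edge_binomial (G H : sgraph) (rho : {rmorphism S -> S}) f :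
    induced_subgraph H G ->
    (forall l, rho 'X_l = if l \in outer_vars H then 0 else 'X_l) ->
  binomial_edge_ideal G f -> binomial_edge_ideal H (rho f).
Proof.
move=> [_ HG] rhoX; have idH := ideal_gen_is_ideal (@edge_binomial H).
elim/ideal_gen_ind: _ / => [|u v|c _ [a [b [ab Gab ->]]]].
- by rewrite rmorph0; apply: ideal0.
- by rewrite rmorphD; apply: idealD.
rewrite rmorphM rmorphB !rmorphM; apply: (idealM idH).
rewrite /xvar /yvar !rhoX !mem_outer_vars !var_vertex_l !var_vertex_r.
have [aH|aH] := boolP (val a \in vertices H); last first.
  by rewrite mul0r mulr0 subrr; apply: ideal0.
have [bH|bH] := boolP (val b \in vertices H); last first.
  by rewrite mul0r mulr0 subrr; apply: ideal0.
by apply: mem_ideal_gen; exists a, b; rewrite HG.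
Qed.

Lemma sub_binomial_edge_ideal (G H : sgraph) (f : S) :
  induced_subgraph H G -> binomial_edge_ideal H f -> binomial_edge_ideal G f.
Proof.
move=> [_ HG]; apply: sub_ideal_gen; first exact: ideal_gen_is_ideal.
move=> _ [a [b [ab Hab ->]]]; apply: mem_ideal_gen; exists a, b; split=> //.
by have /andP[aH bH] := adj_vertices Hab; rewrite -HG.
Qed.

End BinomialEdgeIdeal.

Theorem proposition3p3 (K : fieldType) (G H : sgraph)
    (HG : induced_subgraph H G) (i j s : nat) (hs : (1 <= s)%N)
    (bH bG : nat)
    (hbH : is_graded_betti
             (ideal_pow (@binomial_edge_ideal K (vertices G) H) s) i j bH)
    (hbG : is_graded_betti
             (ideal_pow (@binomial_edge_ideal K (vertices G) G) s) i j bG) :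
  (bH <= bG)%N.
Proof.
case: hbH hbG => [F ->] [F' ->].
have idH := ideal_pow_is_ideal (@binomial_edge_ideal K (vertices G) H) s.
have idG := ideal_pow_is_ideal (@binomial_edge_ideal K (vertices G) G) s.
have [z z_out f|rho [rhoX rho0 rhoT]] :=
    @unipotent_lift_killvars _ _ _ (ungraded F) (outer_vars (vertices G) H) idH.
  exact: divdiff_ideal_pow.
apply: (tor_dim_retract F' idH idG i j _ _ _ rho0 rhoT).
- by apply: ideal_pow_mono => f; apply: sub_binomial_edge_ideal.
- by apply: ideal_pow_rmorph => f; apply: retract_edge_binomial.
- by apply: ideal_pow_hpart; apply: edge_binomial_homog.
Qed.
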